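(* Let $K\subseteq F$ be a field extension, let $\Gamma$ be a linearly ordered (abelian) group with positive cone $\Gamma^+$, and let $S$ be the series ring over $K\subseteq F$ with exponents in $\Gamma^+$. Then $S$ is a pseudo-valuation domain (PVD).
   Context: The positive cone is $\Gamma^+=\{\gamma\in\Gamma : 0\le\gamma\}$. The generalized power series ring $F[[\Gamma^+]]$ is the set of functions $f:\Gamma^+\to F$ whose support is a well-ordered subset of $\Gamma^+$, with pointwise addition and convolution product $(f*g)(m)=\sum_{m_1+m_2=m} f(m_1)g(m_2)$ (sum over $m_1,m_2\in\Gamma^+$). The series ring over $K\subseteq F$ with exponents in $\Gamma^+$ is the subring $S=\{f\in F[[\Gamma^+]] : f(0)\in K\}$. For an integral domain $R$ with quotient field $QF(R)$, a prime ideal $I$ of $R$ is strongly prime if for all $a,b\in QF(R)$, $ab\in I$ implies $a\in I$ or $b\in I$. $R$ is a pseudo-valuation domain (PVD) if every prime ideal of $R$ is strongly prime. *)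

(* Defs.v *)
From HB Require Import structures.
From mathcomp Require Import all_boot all_order all_algebra.
From mathcomp Require Import boolp classical_sets functions cardinality fsbigop.
From mathcomp Require Import ring_quotient fraction.

Set Implicit Arguments.
Unset Strict Implicit.
Unset Printing Implicit Defensive.

Import Order.TTheory GRing.Theory.
Local Open Scope classical_set_scope.
Local Open Scope ring_scope.

(* Linearly ordered abelian groups: the library's [porderZmodType] imposes no
   compatibility between order and addition. *)
HB.mixin Record POrderedZmodule_isLinear G of Num.POrderedZmodule G := {
  lez_total : total (<=%R : rel G);
  lezD2l : forall z x y : G, x <= y -> z + x <= z + y
}.

#[short(type="orderedZmodType")]
HB.structure Definition OrderedZmodule :=
  { G of POrderedZmodule_isLinear G & Num.POrderedZmodule G }.

Section PositiveCone.
Variable G : orderedZmodType.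

Definition nonneg_pred : {pred G} := [pred g | 0 <= g].

Lemma nonneg_addr_closed : addr_closed nonneg_pred.
Proof.
split=> [|x y]; rewrite !inE // => x0 y0.
by apply: (le_trans x0); rewrite -[X in X <= _]addr0; apply: lezD2l.
Qed.
HB.instance Definition _ := GRing.isAddClosed.Build G nonneg_pred
  nonneg_addr_closed.

Record posCone := PosCone { pcval :> G; _ : pcval \in nonneg_pred }.

HB.instance Definition _ := [isSub for pcval].
HB.instance Definition _ := [Choice of posCone by <:].
HB.instance Definition _ :=
  GRing.SubChoice_isSubNmodule.Build G nonneg_pred posCone nonneg_addr_closed.
HB.instance Definition _ :=
  [SubChoice_isSubPOrder of posCone by <: with ring_display].

Lemma posCone_total : total (<=%O : rel posCone).
Proof. by move=> x y; rewrite !leEsub lez_total. Qed.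
HB.instance Definition _ :=
  Order.POrder_isTotal.Build ring_display posCone posCone_total.

End PositiveCone.

Definition well_ordered d (T : orderType d) (A : set T) : Prop :=
  forall B : set T, B `<=` A -> B !=set0 -> exists2 m, B m & lbound B m.

Section WellOrdered.
Variable G : orderedZmodType.
Implicit Types (A B X : set (posCone G)) (x y z : posCone G).

Lemma posCone_addI : right_injective (@GRing.add (posCone G)).
Proof. by move=> x y z /(congr1 val); rewrite /= => /addrI/val_inj. Qed.

Lemma posCone_leD2l x y z : (x + y <= x + z) = (y <= z).
Proof.
rewrite !leEsub /=; apply/idP/idP; last exact: lezD2l.
by move=> /(lezD2l (- val x)); rewrite !addKr.
Qed.

Lemma posCone_leD x y z t : x <= y -> z <= t -> x + z <= y + t.
Proof.
move=> xy zt; apply: (@le_trans _ _ (x + t)); first by rewrite posCone_leD2l.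
by rewrite addrC [y + t]addrC posCone_leD2l.
Qed.

Lemma well_orderedS A B : A `<=` B -> well_ordered B -> well_ordered A.
Proof. by move=> AB woB C CA; apply: woB; apply: subset_trans AB. Qed.

Lemma well_ordered1 x : well_ordered [set x].
Proof.
move=> B Bx [y By]; exists y => // z Bz.
by rewrite (Bx _ By) (Bx _ Bz).
Qed.

Lemma well_orderedU A B :
  well_ordered A -> well_ordered B -> well_ordered (A `|` B).
Proof.
move=> woA woB C CAB [c Cc].
have [CA|/set0P CA] := eqVneq (C `&` A) set0.
  apply: woB; last by exists c.
  move=> z Cz; case: (CAB _ Cz) => // Az.
  by have : (C `&` A) z by []; rewrite CA.
have [CB|/set0P CB] := eqVneq (C `&` B) set0.
  apply: woA; last by exists c.
  move=> z Cz; case: (CAB _ Cz) => // Bz.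
  by have : (C `&` B) z by []; rewrite CB.
have [a [Ca Aa] amin] := woA _ (@subIsetr _ C A) CA.
have [b [Cb Bb] bmin] := woB _ (@subIsetr _ C B) CB.
have [ab|/ltW ba] := leP a b.
  exists a => // z Cz; case: (CAB _ Cz) => [Az|Bz]; first exact: amin.
  by apply: le_trans ab _; apply: bmin.
exists b => // z Cz; case: (CAB _ Cz) => [Az|Bz]; last exact: bmin.
by apply: le_trans ba _; apply: amin.
Qed.

Lemma well_ordered_ind A (P : posCone G -> Prop) : well_ordered A ->
  (forall a, A a -> (forall c, A c -> c < a -> P c) -> P a) ->
  forall a, A a -> P a.
Proof.
move=> woA step a Aa; apply: contrapT => nPa.
have [||m [Am nPm] mmin] := woA [set c | A c /\ ~ P c]; first by move=> c [].
  by exists a.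
apply: nPm; apply: step => // c Ac cm; apply: contrapT => nPc.
by have := mmin c (conj Ac nPc); rewrite leNgt cm.
Qed.

Lemma well_ordered_finite A : well_ordered A ->
  (forall B, B `<=` A -> B !=set0 -> exists2 m, B m & ubound B m) ->
  finite_set A.
Proof.
move=> woA maxA.
have fin_le a : A a -> finite_set [set x | A x /\ x <= a].
  move: a; apply: (well_ordered_ind woA) => a Aa IH.
  pose B := [set x | A x /\ x < a].
  suff finB : finite_set B.
    apply: (@sub_finite_set _ _ (B `|` [set a])); last first.
      by rewrite finite_setU; split => //; apply: finite_set1.
    move=> x [Ax]; rewrite le_eqVlt => /orP[/eqP ->|xa]; first by right.
    by left.
  have [->|/set0P B0] := eqVneq B set0; first exact: finite_set0.
  have [|m [Am ma] mmax] := maxA B _ B0; first by move=> x [].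
  apply: sub_finite_set (IH m Am ma) => x [Ax xa]; split => //.
  exact: mmax.
have [->|/set0P A0] := eqVneq A set0; first exact: finite_set0.
have [m Am mmax] := maxA A (fun x => id) A0.
by apply: sub_finite_set (fin_le m Am) => x Ax; split => //; apply: mmax.
Qed.

Definition summands A B (m : posCone G) : set (posCone G * posCone G) :=
  [set p | [/\ A p.1, B p.2 & p.1 + p.2 = m]].

Lemma finite_summands A B m : well_ordered A -> well_ordered B ->
  finite_set (summands A B m).
Proof.
move=> woA woB; pose D := [set p.1 | p in summands A B m].
have finD : finite_set D.
  apply: well_ordered_finite => [|C CD [c Cc]].
    by apply: well_orderedS woA => _ [p [] ? _ _ <-].
  have [||b [Bb [a Ca abm]] bmin] :=
    woB [set b | B b /\ exists2 a, C a & a + b = m]; first by move=> b [].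
    have [p [Ap Bp pm] pc] := CD _ Cc.
    by exists p.2; split => //; exists c => //; rewrite -pc.
  exists a => // a' Ca'; have [p [Ap Bp pm] pc] := CD _ Ca'.
  have := bmin p.2; rewrite /= => /(_ (conj Bp _)) ble.
  have {}ble : b <= p.2 by apply: ble; exists a' => //; rewrite -pc.
  rewrite leNgt; apply/negP => aa'.
  have : a' + b <= a + b by rewrite abm -pm -pc posCone_leD2l.
  by rewrite addrC [a + b]addrC posCone_leD2l leNgt aa'.
apply: (@sub_finite_set _ _ (D `*` [set b | exists2 a, D a & a + b = m])).
  move=> p sp; have [Ap Bp pm] := sp.
  by split=> /=; [exists p | exists p.1 => //; exists p].
apply: finite_setX => //.
pose h a := xget (0 : posCone G) [set b | a + b = m].
apply: (@sub_finite_set _ _ (h @` D)); last exact: finite_image.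
move=> b [a Da abm]; exists a => //; rewrite /h; case: xgetP => [b' _ /= e|].
  by apply: (@posCone_addI a); rewrite e.
by move=> /(_ b).
Qed.

Lemma well_orderedD A B : well_ordered A -> well_ordered B ->
  well_ordered [set m | exists2 a, A a & exists2 b, B b & a + b = m].
Proof.
move=> woA woB X XAB [x0 Xx0].
pose P := [set p : posCone G * posCone G | [/\ A p.1, B p.2 & X (p.1 + p.2)]].
(* least pair sums among the pairs of [P] with first component in [Q] *)
pose has_min (Q : set (posCone G)) := (exists2 p, P p & Q p.1) ->
  exists2 p, P p /\ Q p.1 & forall q, P q -> Q q.1 -> p.1 + p.2 <= q.1 + q.2.
have step (Q : set (posCone G)) :
    (forall a, A a -> Q a -> has_min [set c | Q c /\ c < a]) -> has_min Q.
  move=> IH [p Pp Qp].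
  have [||b [Bb [a [Aa Xab] Qa]] bmin] := woB [set b | B b /\
      exists2 a, A a /\ X (a + b) & Q a]; first by move=> b [].
    by case: Pp => Ap Bp Xp; exists p.2; split => //; exists p.1.
  have high q : P q -> Q q.1 -> a <= q.1 -> a + b <= q.1 + q.2.
    case=> Aq Bq Xq Qq aq; apply: posCone_leD => //; apply: bmin.
    by split => //; exists q.1.
  have [low|nlow] := pselect (exists2 p, P p & Q p.1 /\ p.1 < a); last first.
    exists (a, b); first by [].
    move=> q Pq Qq /=; apply: high => //; rewrite leNgt; apply/negP => qa.
    by apply: nlow; exists q.
  have [r [Pr [Qr ra]] rmin] := IH a Aa Qa low.
  have [rab|/ltW abr] := leP (r.1 + r.2) (a + b).
    exists r => // q Pq Qq; have [aq|qa] := leP a q.1.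
      exact: le_trans rab (high _ Pq Qq aq).
    exact: rmin.
  exists (a, b); first by [].
  move=> q Pq Qq /=; have [aq|qa] := leP a q.1; first exact: high.
  exact: le_trans abr (rmin _ Pq (conj Qq qa)).
have below a : A a -> has_min [set c | c < a].
  move: a; apply: (well_ordered_ind woA) => a Aa IH; apply: step => c Ac /= ca.
  have -> : [set d | d < a /\ d < c] = [set d | d < c].
    apply/seteqP; split=> d /=; first by case.
    by move=> dc; split => //; apply: lt_trans ca.
  exact: IH.
have [||p [[Ap Bp Xp] _] pmin] := step setT.
- move=> a Aa _; have -> : [set c | setT c /\ c < a] = [set c | c < a].
    by apply/seteqP; split=> d /= => [[]|].
  exact: below.
- have [a Aa [b Bb abx]] := XAB _ Xx0.
  by exists (a, b) => //; split => //=; rewrite abx.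
exists (p.1 + p.2) => // x Xx; have [a Aa [b Bb abx]] := XAB _ Xx.
by rewrite -abx; apply: (pmin (a, b)) => //; split => //=; rewrite abx.
Qed.

End WellOrdered.

Definition nzsupp (T : Type) (V : nmodType) (f : T -> V) : set T :=
  [set m | f m != 0].

Definition wo_pred (G : orderedZmodType) (F : fieldType) :
    {pred posCone G -> F} :=
  [pred f : posCone G -> F | `[< well_ordered (nzsupp f) >]].

Arguments wo_pred : clear implicits.

(* F[[G^+]]; the ring structure, with product [convol], comes below. *)
Record gpseries (G : orderedZmodType) (F : fieldType) :=
  GPSeries { coef :> posCone G -> F; _ : coef \in wo_pred G F }.

HB.instance Definition _ G F := [isSub for @coef G F].
HB.instance Definition _ G F := [Choice of gpseries G F by <:].

Section GPSeries.
Variables (G : orderedZmodType) (F : fieldType).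
Implicit Types f g h : posCone G -> F.

Lemma wo_zmod_closed : zmod_closed (wo_pred G F).
Proof.
split=> [|f g]; rewrite !inE.
  move=> B B0 [b Bb]; have := B0 _ Bb.
  by rewrite /nzsupp /= eqxx.
move=> wof wog.
apply: well_orderedS (well_orderedU wof wog) => m /=; rewrite /nzsupp /=.
have -> : (f - g) m = f m - g m by [].
have [->|fm] := eqVneq (f m) 0; last by left.
by rewrite sub0r oppr_eq0; right.
Qed.
HB.instance Definition _ := GRing.SubChoice_isSubZmodule.Build
  (posCone G -> F) (wo_pred G F) (gpseries G F) wo_zmod_closed.

(* [\sum_(p \in A)] is a sum over a set, meaningful when the summand has finite
   support on [A]; [finite_summands] shows this for well-ordered supports. *)
Definition convol f g (m : posCone G) : F :=
  \sum_(p \in [set p : posCone G * posCone G | p.1 + p.2 = m]) f p.1 * g p.2.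

Lemma convol_seq f g m (A B : seq (posCone G)) : uniq A -> uniq B ->
    (forall a b, a + b = m -> f a != 0 -> g b != 0 -> a \in A /\ b \in B) ->
  convol f g m =
    \sum_(a <- A) \sum_(b <- B) if a + b == m then f a * g b else 0.
Proof.
move=> uA uB AB; rewrite /convol.
pose r := [seq p <- [seq (a, b) | a <- A, b <- B] | p.1 + p.2 == m].
rewrite (@fsbigE _ _ _ _ _ r).
- transitivity (\sum_(p <- r) f p.1 * g p.2).
    rewrite [LHS]big_seq_cond [RHS]big_seq_cond; apply: eq_bigl => p.
    rewrite andbT andb_idr // mem_filter => /andP[/eqP pm _].
    by rewrite inE.
  by rewrite big_filter big_mkcond /= big_allpairs.
- apply: filter_uniq; apply: allpairs_uniq => //.
  by move=> [? ?] [? ?] _ _ [-> ->].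
- by move=> p /=; rewrite mem_filter => /andP[/eqP].
move=> [a b] /= abm; rewrite mem_filter /= abm eqxx /= => nab.
have [->|fa] := eqVneq (f a) 0; first by rewrite mul0r.
have [->|gb] := eqVneq (g b) 0; first by rewrite mulr0.
by have [Aa Bb] := AB _ _ abm fa gb; rewrite (allpairs_f pair Aa Bb) in nab.
Qed.

Lemma convolC f g : convol f g = convol g f.
Proof.
apply/funext => m; rewrite /convol.
rewrite (@reindex_fsbig _ _ _ _ _ (fun p => (p.2, p.1))
  [set p : posCone G * posCone G | p.1 + p.2 = m]
  [set p : posCone G * posCone G | p.1 + p.2 = m]).
  by apply: eq_fsbigr => p _ /=; rewrite mulrC.
split.
- by move=> p /=; rewrite addrC.
- by move=> [? ?] [? ?] _ _ [-> ->].
- by move=> p /= pm; exists (p.2, p.1); [rewrite /= addrC | case: p pm].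
Qed.

Lemma convol_supp f g :
  nzsupp (convol f g) `<=`
  [set m | exists2 a, nzsupp f a & exists2 b, nzsupp g b & a + b = m].
Proof.
move=> m /= nz; apply: contrapT => nex; move/negP: nz; apply; apply/eqP.
apply: fsbig1 => p /= pm.
have [->|fa] := eqVneq (f p.1) 0; first by rewrite mul0r.
have [->|gb] := eqVneq (g p.2) 0; first by rewrite mulr0.
by case: nex; exists p.1 => //; exists p.2.
Qed.

Lemma convol_wo f g : well_ordered (nzsupp f) -> well_ordered (nzsupp g) ->
  well_ordered (nzsupp (convol f g)).
Proof.
move=> wof wog.
exact: well_orderedS (@convol_supp f g) (well_orderedD wof wog).
Qed.

Lemma summands_seq (A B : set (posCone G)) m :
    well_ordered A -> well_ordered B ->
  exists r : seq (posCone G * posCone G),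
    forall p, p \in r <-> summands A B m p.
Proof.
move=> woA woB; have /finite_seqP[r ->] := finite_summands m woA woB.
by exists r => p; split.
Qed.


Lemma triple_seq (A B C : set (posCone G)) m :
    well_ordered A -> well_ordered B -> well_ordered C ->
  exists r : seq (posCone G), uniq r /\
    forall a b c, a + b + c = m -> A a -> B b -> C c ->
      [/\ a \in r, b \in r & c \in r].
Proof.
move=> woA woB woC.
have [s sP] := summands_seq m (well_orderedD woA woB) woC.
have /choice[t tP] : forall x, exists r : seq (posCone G * posCone G),
  forall p, p \in r <-> summands A B x p by move=> x; apply: summands_seq.
pose u := flatten [seq t p.1 | p <- s].
exists (undup ([seq p.1 | p <- u] ++ [seq p.2 | p <- u] ++ [seq p.2 | p <- s])).
split; first exact: undup_uniq.
move=> a b c abcm Aa Bb Cc; rewrite !mem_undup !mem_cat.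
have sabc : (a + b, c) \in s.
  by apply/sP; split => //=; exists a => //; exists b.
have uab : (a, b) \in u.
  apply/flattenP; exists (t (a + b)); last exact/tP.
  by apply/mapP; exists (a + b, c).
have ua : a \in [seq p.1 | p <- u] by apply/mapP; exists (a, b).
have ub : b \in [seq p.2 | p <- u] by apply/mapP; exists (a, b).
have sc : c \in [seq p.2 | p <- s] by apply/mapP; exists (a + b, c).
by rewrite ua ub sc !orbT.
Qed.

Lemma convol3 f g h m (r : seq (posCone G)) : uniq r ->
    (forall a b c, a + b + c = m -> nzsupp f a -> nzsupp g b -> nzsupp h c ->
      [/\ a \in r, b \in r & c \in r]) ->
  convol (convol f g) h m = \sum_(a <- r) \sum_(b <- r) \sum_(c <- r)
      if a + b + c == m then f a * g b * h c else 0.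
Proof.
move=> ur rP.
pose X := undup [seq a + b | a <- r, b <- r].
rewrite (@convol_seq _ _ _ X r) ?undup_uniq //; last first.
  move=> x c xcm fgx hc; have [a fa [b gb abx]] := convol_supp fgx.
  have abcm : a + b + c = m by rewrite abx.
  have [ra rb rc] := rP a b c abcm fa gb hc; split=> //.
  by rewrite mem_undup -abx; apply: allpairs_f.
transitivity (\sum_(x <- X) \sum_(c <- r) \sum_(a <- r) \sum_(b <- r)
   if a + b == x then if a + b + c == m then f a * g b * h c else 0 else 0).
  apply: eq_bigr => x _; apply: eq_bigr => c _.
  have [xcm|xcm] := eqVneq (x + c) m; last first.
    rewrite big1 // => a _; rewrite big1 // => b _.
    by case: eqP => // ->; rewrite (negPf xcm).
  have [->|hc] := eqVneq (h c) 0.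
    rewrite mulr0 big1 // => a _; rewrite big1 // => b _.
    by rewrite mulr0; do 2?case: ifP.
  rewrite (@convol_seq _ _ _ r r) //; last first.
    move=> a b abx fa gb; have abcm : a + b + c = m by rewrite abx.
    by have [] := rP a b c abcm fa gb hc.
  rewrite big_distrl /=; apply: eq_bigr => a _.
  rewrite big_distrl /=; apply: eq_bigr => b _.
  by case: eqP => [->|]; rewrite ?xcm ?eqxx // mul0r.
rewrite exchange_big /=.
under eq_bigr do rewrite exchange_big /=.
rewrite exchange_big /=; rewrite [LHS]big_seq [RHS]big_seq.
apply: eq_bigr => a ra.
under eq_bigr do rewrite exchange_big /=.
rewrite exchange_big /=; rewrite [LHS]big_seq [RHS]big_seq.
apply: eq_bigr => b rb; apply: eq_bigr => c _.
rewrite (bigD1_seq (a + b)) ?undup_uniq ?mem_undup ?allpairs_f //= eqxx.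
by rewrite big1 ?addr0 // => x /negPf; rewrite eq_sym => ->.
Qed.

Lemma convolA f g h : well_ordered (nzsupp f) -> well_ordered (nzsupp g) ->
    well_ordered (nzsupp h) ->
  convol f (convol g h) = convol (convol f g) h.
Proof.
move=> wof wog woh; apply/funext => m.
have [r [ur rP]] := triple_seq m wof wog woh.
rewrite (convol3 ur rP) convolC (convolC g h).
rewrite (@convol3 _ _ _ _ r) //; last first.
  move=> c b a cbam hc gb fa.
  have [] := rP a b c _ fa gb hc; last by [].
  by rewrite -cbam [c + b]addrC [RHS]addrC addrA.
rewrite exchange_big /=; under eq_bigr do rewrite exchange_big /=.
rewrite exchange_big /=; apply: eq_bigr => a _; apply: eq_bigr => b _.
apply: eq_bigr => c _.
rewrite [c + b]addrC [_ + a]addrC addrA.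
by rewrite [h c * _]mulrC [_ * f a]mulrC mulrA.
Qed.

Definition one_fun (m : posCone G) : F := if m == 0 then 1 else 0.

Lemma one_fun_wo : well_ordered (nzsupp one_fun).
Proof.
apply: well_orderedS (@well_ordered1 _ 0) => m; rewrite /nzsupp /one_fun /=.
by have [->|_] := eqVneq m 0; rewrite ?eqxx.
Qed.

Lemma convol1f f : convol one_fun f = f.
Proof.
apply/funext => m; rewrite (@convol_seq _ _ _ [:: 0] [:: m]) //.
  by rewrite !big_seq1 add0r eqxx /one_fun eqxx mul1r.
move=> a b; rewrite /one_fun; have [->|_] := eqVneq a 0; last by rewrite eqxx.
by rewrite add0r => ->; rewrite !inE !eqxx.
Qed.

Lemma convolDl f g h : well_ordered (nzsupp f) -> well_ordered (nzsupp g) ->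
    well_ordered (nzsupp h) ->
  convol (f + g) h = convol f h + convol g h.
Proof.
move=> wof wog woh; apply/funext => m.
have [s sP] := summands_seq m (well_orderedU wof wog) woh.
pose A := undup [seq p.1 | p <- s]; pose B := undup [seq p.2 | p <- s].
have AB a b : a + b = m -> (nzsupp f `|` nzsupp g) a -> nzsupp h b ->
    a \in A /\ b \in B.
  move=> abm fga hb; have sab : (a, b) \in s by apply/sP.
  by rewrite !mem_undup; split; apply/mapP; exists (a, b).
have fgE x : (f + g) x = f x + g x by [].
have -> : (convol f h + convol g h) m = convol f h m + convol g h m by [].
rewrite !(@convol_seq _ _ _ A B) ?undup_uniq //.
- rewrite -big_split /=; apply: eq_bigr => a _.
  rewrite -big_split /=; apply: eq_bigr => b _.
  by case: ifP; rewrite ?addr0 // fgE mulrDl.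
- by move=> a b abm ga; apply: AB => //; right.
- by move=> a b abm fa; apply: AB => //; left.
move=> a b abm fga; apply: AB => //.
rewrite /nzsupp /=; have [fa|fa] := eqVneq (f a) 0; last by left.
by right; move: fga; rewrite fgE fa add0r.
Qed.

Lemma convol_neq0 f g : well_ordered (nzsupp f) -> well_ordered (nzsupp g) ->
  f != 0 -> g != 0 -> convol f g != 0.
Proof.
move=> wof wog.
have lead (k : posCone G -> F) : well_ordered (nzsupp k) -> k != 0 ->
    exists2 a, nzsupp k a & lbound (nzsupp k) a.
  move=> wok k0; apply: wok => //; apply: contrapT => nex; move/eqP: k0; apply.
  apply/funext => x; apply/eqP/negPn/negP => kx; apply: nex; by exists x.
move=> /(lead _ wof)[a fa amin] /(lead _ wog)[b gb bmin].
apply/eqP => /(congr1 (fun k => k (a + b))).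
rewrite (@convol_seq _ _ _ [:: a] [:: b]) //.
  by rewrite !big_seq1 eqxx => /eqP; rewrite mulf_eq0 (negPf fa) (negPf gb).
move=> x y xyab fx gy; have ax := amin _ fx; have by_ := bmin _ gy.
have xa : x = a.
  apply/eqP; rewrite eq_le ax andbT leNgt; apply/negP => ltax.
  have := posCone_leD2l y x a; rewrite [y + x]addrC xyab [y + a]addrC.
  by rewrite posCone_leD2l by_ leNgt ltax.
by move: xyab; rewrite xa => /posCone_addI ->; rewrite !inE !eqxx.
Qed.

Implicit Types u v w : gpseries G F.

Lemma gpseries_wo u : well_ordered (nzsupp u).
Proof. by have := valP u; rewrite inE. Qed.

Fact gps_mul_subproof u v : convol u v \in wo_pred G F.
Proof. by rewrite inE; apply/convol_wo; apply: gpseries_wo. Qed.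
Definition gps_mul u v : gpseries G F := GPSeries (gps_mul_subproof u v).

Fact gps_one_subproof : one_fun \in wo_pred G F.
Proof. by rewrite inE; apply: one_fun_wo. Qed.
Definition gps_one : gpseries G F := GPSeries gps_one_subproof.

Lemma gps_mulA : associative gps_mul.
Proof.
move=> u v w; apply: val_inj => /=.
by apply: convolA; apply: gpseries_wo.
Qed.

Lemma gps_mulC : commutative gps_mul.
Proof. by move=> u v; apply: val_inj; apply: convolC. Qed.

Lemma gps_mul1 : left_id gps_one gps_mul.
Proof. by move=> u; apply: val_inj; apply: convol1f. Qed.

Lemma gps_mulDl : left_distributive gps_mul +%R.
Proof.
move=> u v w; apply: val_inj => /=.
by apply: convolDl; apply: gpseries_wo.
Qed.

Lemma gps_one_neq0 : gps_one != 0.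
Proof.
apply/eqP => /(congr1 (fun u => val u 0)) /= /eqP.
by rewrite /one_fun eqxx; apply/negP/oner_neq0.
Qed.

HB.instance Definition _ := GRing.Zmodule_isComNzRing.Build (gpseries G F)
  gps_mulA gps_mulC gps_mul1 gps_mulDl gps_one_neq0.

Lemma gps_mul_eq0 u v : u * v = 0 -> (u == 0) || (v == 0).
Proof.
move=> uv0; apply/norP => -[u0 v0].
have nz w : w != 0 -> val w != 0 by rewrite -(inj_eq val_inj).
have := convol_neq0 (@gpseries_wo u) (@gpseries_wo v) (nz _ u0) (nz _ v0).
by apply/negP/negPn/eqP/(congr1 val uv0).
Qed.

Lemma coefM0 u v : (u * v) 0 = u 0 * v 0.
Proof.
rewrite /= (@convol_seq _ _ _ [:: 0] [:: 0]) //.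
  by rewrite !big_seq1 addr0 eqxx.
move=> a b ab0 _ _; have {}ab0 : val a + val b = 0 := congr1 val ab0.
have a0 : 0 <= val a by have := valP a.
have b0 : 0 <= val b by have := valP b.
have vb : val b = 0.
  apply/eqP; rewrite eq_le b0 andbT.
  by have := lezD2l (val b) _ _ a0; rewrite addr0 addrC ab0.
move: ab0; rewrite vb addr0 => va.
by rewrite !inE -!(inj_eq val_inj) /= va vb !eqxx.
Qed.

End GPSeries.

Section SeriesRing.
Variables (G : orderedZmodType) (F : fieldType) (K : divringClosed F).

Definition const_in_pred : {pred gpseries G F} := [pred u | coef u 0 \in K].

Lemma const_in_subring : subring_closed const_in_pred.
Proof.
split=> [|u v|u v]; rewrite !inE.
- by rewrite /= /one_fun eqxx rpred1.
- have -> : coef (u - v) 0 = coef u 0 - coef v 0 by [].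
  exact: rpredB.
by rewrite coefM0; apply: rpredM.
Qed.

(* S = {u in F[[G^+]] : u 0 in K}. *)
Record series_ring :=
  SeriesRing { series :> gpseries G F; _ : series \in const_in_pred }.

HB.instance Definition _ := [isSub for series].
HB.instance Definition _ := [Choice of series_ring by <:].
HB.instance Definition _ := GRing.SubChoice_isSubComNzRing.Build
  (gpseries G F) const_in_pred series_ring const_in_subring.

Implicit Types x y : series_ring.

(* [unitRingType] asks for a total inverse; it is obtained by choice. *)
Definition sr_unit : {pred series_ring} :=
  [pred x | `[< exists y, y * x = 1 >]].
Definition sr_inv x : series_ring :=
  if x \in sr_unit then xget x [set y | y * x = 1] else x.

Lemma sr_mulVx : {in sr_unit, left_inverse 1 sr_inv *%R}.
Proof.
move=> x xu; rewrite /sr_inv xu; case: xgetP => // nx.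
by move: xu; rewrite inE => -[y /nx].
Qed.

Lemma sr_unitP x y : y * x = 1 -> x \in sr_unit.
Proof. by move=> yx; rewrite inE; exists y. Qed.

Lemma sr_inv_out : {in [predC sr_unit], sr_inv =1 id}.
Proof. by move=> x; rewrite inE /= /sr_inv => /negPf ->. Qed.

HB.instance Definition _ := GRing.ComNzRing_hasMulInverse.Build series_ring
  sr_mulVx sr_unitP sr_inv_out.

Lemma sr_mul_eq0 x y : x * y = 0 -> (x == 0) || (y == 0).
Proof.
by move=> /(congr1 val) /gps_mul_eq0; rewrite -!(inj_eq val_inj).
Qed.

HB.instance Definition _ := GRing.ComUnitRing_isIntegral.Build series_ring
  sr_mul_eq0.

End SeriesRing.

(* [prime_idealr] bundles properness ([1 \notin I]), so [R] itself is excluded.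
   Elements of [{fraction R}] are members of [I] when they lie in the image of
   [I] under the canonical embedding. *)
Definition strongly_prime (R : idomainType) (I : prime_idealr R) : Prop :=
  let I_QF : set {fraction R} := [set FracField.tofrac z | z in [set` I]] in
  forall a b : {fraction R}, I_QF (a * b) -> I_QF a \/ I_QF b.

Definition pvd (R : idomainType) : Prop :=
  forall I : prime_idealr R, strongly_prime I.

(* Main.v *)
Require Import Defs.
From mathcomp Require Import all_boot all_order all_algebra.
From mathcomp Require Import boolp classical_sets.
From mathcomp Require Import ring_quotient fraction.

(* F[[G^+]] is a valuation ring: if the least exponent of [d] is at most that
   of [n], then [d] divides [n].  Instead of inverting a unit through Neumann's
   lemma, the quotient is built as the union of all partial quotients, i.e. the
   series [q] such that [d * q] agrees with [n] up to the exponents produced by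
   the support of [q]; they are initial segments of one another, and a union
   that did not solve the equation could be prolonged by one monomial.

   Let [M] be the series with constant coefficient 0; [M] is an ideal of
   F[[G^+]] contained in [S], and every prime ideal [I] of [S] lies in [M],
   because a series with nonzero constant coefficient in [K] is a unit of [S].
   Let [a * b = p] be in [I].  Either [a] and [b] are both in [M], hence in [S],
   and primality applies, or, say, [a^-1] is in F[[G^+]]; then [b = p * a^-1]
   is in [M] and [b ^+ 2 = p * (p * a^-2)] is in [I], hence so is [b]. *)

Set Implicit Arguments.
Unset Strict Implicit.
Unset Printing Implicit Defensive.

Import Order.TTheory GRing.Theory.
Local Open Scope classical_set_scope.
Local Open Scope ring_scope.

(** * Leading terms of products of series *)

Section LeadingCoefficient.
Variables (G : orderedZmodType) (F : fieldType).
Implicit Types (u v : gpseries G F) (x y a b m c : posCone G) (k : F).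

Lemma posCone_ge0 x : (0 : posCone G) <= x.
Proof. by rewrite leEsub; have := valP x. Qed.

Lemma posCone_subr x y : x <= y -> exists z, y = x + z.
Proof.
rewrite leEsub => xy.
have yx : val y - val x \in @nonneg_pred G.
  by rewrite inE; have := lezD2l (- val x) _ _ xy; rewrite addNr addrC.
by exists (PosCone yx); apply: val_inj; rewrite /= addrC subrK.
Qed.

Lemma coefB u v x : coef (u - v) x = coef u x - coef v x.
Proof. by []. Qed.

Lemma coefD u v x : coef (u + v) x = coef u x + coef v x.
Proof. by []. Qed.

Lemma gpseriesP u v : (forall x, coef u x = coef v x) -> u = v.
Proof. by move=> uv; apply: val_inj; apply/funext. Qed.

Lemma exists_lead u : u != 0 ->
  exists2 a, coef u a != 0 & forall x, x < a -> coef u x = 0.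
Proof.
move=> u0; have [||a ua amin] := @gpseries_wo _ _ u (nzsupp (coef u)) => //.
  apply: contrapT => nex; move/eqP: u0; apply; apply: gpseriesP => x.
  by apply/eqP/negPn/negP => ux; apply: nex; exists x.
exists a => // x xa; apply/eqP/negPn/negP => ux.
by have := amin _ ux; rewrite leNgt xa.
Qed.

Lemma coefM_lead u v a b :
    (forall x, x < a -> coef u x = 0) -> (forall x, x < b -> coef v x = 0) ->
  coef (u * v) (a + b) = coef u a * coef v b.
Proof.
move=> ua vb; rewrite [LHS](@convol_seq _ _ _ _ _ [:: a] [:: b]) //.
  by rewrite !big_seq1 eqxx.
move=> x y xyab ux vy.
have ax : a <= x by rewrite leNgt; apply: contra ux => /ua ->.
have by_ : b <= y by rewrite leNgt; apply: contra vy => /vb ->.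
have yb : y = b.
  apply/eqP; rewrite eq_le by_ andbT -(posCone_leD2l a) -xyab.
  by rewrite ![_ + y]addrC posCone_leD2l.
move: xyab; rewrite yb ![_ + b]addrC => /posCone_addI ->.
by rewrite !inE !eqxx.
Qed.

Lemma coefM_below u v a b :
    (forall x, x < a -> coef u x = 0) -> (forall x, x < b -> coef v x = 0) ->
  forall m, m < a + b -> coef (u * v) m = 0.
Proof.
move=> ua vb m mab; rewrite [LHS](@convol_seq _ _ _ _ _ [::] [::]) //.
  by rewrite big_nil.
move=> x y xym ux vy; move: mab; rewrite ltNge -xym posCone_leD //.
  by rewrite leNgt; apply: contra ux => /ua ->.
by rewrite leNgt; apply: contra vy => /vb ->.
Qed.

Lemma coefM_le u v a b :
    (forall x, x < a -> coef u x = 0) -> (forall x, x <= b -> coef v x = 0) ->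
  forall m, m <= a + b -> coef (u * v) m = 0.
Proof.
move=> ua vb m; have vb' x (xb : x < b) := vb x (ltW xb).
rewrite le_eqVlt => /orP[/eqP ->|]; last exact: coefM_below.
by rewrite coefM_lead // vb // mulr0.
Qed.

Definition monom_fun (c : posCone G) (k : F) (x : posCone G) : F :=
  if x == c then k else 0.

Fact monom_subproof c k : monom_fun c k \in wo_pred G F.
Proof.
rewrite inE; apply: well_orderedS (@well_ordered1 _ c) => x.
by rewrite /nzsupp /monom_fun /=; have [->|_] := eqVneq x c; rewrite ?eqxx.
Qed.
Definition monom c k : gpseries G F := GPSeries (monom_subproof c k).

Lemma coef_monom c k x : coef (monom c k) x = if x == c then k else 0.
Proof. by []. Qed.

End LeadingCoefficient.

(** * Division of power series *)

Section Division.
Variables (G : orderedZmodType) (F : fieldType) (n d : gpseries G F).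
Variable a : posCone G.
Hypothesis da : coef d a != 0.
Hypothesis d_below : forall x, x < a -> coef d x = 0.
Hypothesis n_below : forall x, x < a -> coef n x = 0.
Implicit Types (p q : gpseries G F) (x y : posCone G).

(** The bound includes [a + x], the first exponent of [d * q] to which the coefficient of [q] at [x]
    contributes. *)
Definition partial_quotient q := forall x, coef q x != 0 ->
  forall y, y <= a + x -> coef (d * q) y = coef n y.

(* At the least exponent where [p] and [q] differ, [d * p] and [d * q] differ
   too, so that at most one of [p] and [q] has support reaching that far. *)
Lemma partial_quotient_comparable p q x :
    partial_quotient p -> partial_quotient q -> coef p x != 0 ->
  (forall y, y <= x -> coef q y = coef p y) \/
  (forall y, x <= y -> coef q y = 0).
Proof.
move=> pqp pqq px; have [->|] := eqVneq p q; first by left.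
rewrite -subr_eq0 => /exists_lead[m pqm m_below].
have [xm|mx] := ltP x m.
  left=> y yx; apply/esym/eqP; rewrite -subr_eq0 -coefB m_below //.
  exact: le_lt_trans xm.
right=> y xy; apply/eqP/negPn/negP => qy.
have amE : coef (d * (p - q)) (a + m) = coef d a * coef (p - q) m.
  exact: coefM_lead.
have := mulf_neq0 da pqm; rewrite -amE mulrBr coefB.
rewrite (pqp x px) ?posCone_leD2l // (pqq y qy) ?subrr ?eqxx //.
by rewrite posCone_leD2l (le_trans mx).
Qed.

(** The default 0 serves where every partial quotient vanishes; elsewhere [union_funE] shows that
    the choice of [p] is immaterial. *)
Definition union_fun x : F := xget 0
  [set c | exists p, [/\ partial_quotient p, coef p x != 0 & coef p x = c]].

Lemma union_fun_neq0 x : union_fun x != 0 ->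
  exists p, [/\ partial_quotient p, coef p x != 0 & coef p x = union_fun x].
Proof. by rewrite /union_fun; case: xgetP => [_ _ //|_]; rewrite eqxx. Qed.

Lemma union_funE p x y : partial_quotient p -> coef p x != 0 -> y <= x ->
  union_fun y = coef p y.
Proof.
move=> pqp px yx; have [uy0|/union_fun_neq0[q [pqq qy <-]]] :=
  eqVneq (union_fun y) 0.
  move: uy0; rewrite /union_fun; case: xgetP => [c _ [q [_ qy qc]] c0|nex _].
    by rewrite qc c0 eqxx in qy.
  by apply/esym/eqP/negPn/negP => py; apply: (nex (coef p y)); exists p.
have [pq|q0] := partial_quotient_comparable pqp pqq px; first exact: pq.
(* With the roles exchanged, only agreement up to [y] is possible, since [p] is nonzero at
   [x >= y]. *)
have [pq|p0] := partial_quotient_comparable pqq pqp qy; first by rewrite pq.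
by rewrite p0 ?eqxx in px.
Qed.

(** Up to any exponent of its support the union coincides with a single partial quotient, whose
    support is well-ordered. *)
Fact union_subproof : union_fun \in wo_pred G F.
Proof.
rewrite inE => B Bu [b Bb]; have [p [pqp pb _]] := union_fun_neq0 (Bu _ Bb).
have [||m [Bm mb] mmin] := gpseries_wo (u := p) (B := [set x | B x /\ x <= b]).
- move=> x [Bx xb]; rewrite /nzsupp /= -(union_funE pqp pb xb).
  exact: Bu.
- by exists b.
exists m => // z Bz; have [zb|/ltW bz] := leP z b; first exact: mmin.
exact: le_trans bz.
Qed.
Definition union_quotient : gpseries G F := GPSeries union_subproof.

Lemma union_partial_quotient : partial_quotient union_quotient.
Proof.
move=> x /union_fun_neq0[p [pqp px _]] y yx.
rewrite -(pqp x px y yx); apply/eqP; rewrite -subr_eq0 -coefB -mulrBr.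
apply/eqP; apply: (coefM_le d_below _ yx) => z zx.
by rewrite coefB /= (union_funE pqp px zx) subrr.
Qed.

Lemma gps_divides : exists q, n = d * q.
Proof.
exists union_quotient; set q := union_quotient; apply/eqP; rewrite -subr_eq0.
apply: contrapT => /negP /exists_lead[m rm r_below].
have /posCone_subr[c mac] : a <= m.
  rewrite leNgt; apply: contra rm => ma; rewrite coefB n_below // sub0r oppr_eq0.
  by rewrite (@coefM_below _ _ _ _ a 0) ?addr0 // => x; rewrite ltNge posCone_ge0.
rewrite {m}mac in rm r_below.
have q_ge x : c <= x -> coef q x = 0.
  move=> cx; apply: contrapT => /eqP qx; move: rm.
  by rewrite coefB (union_partial_quotient qx) ?posCone_leD2l // subrr eqxx.
(* Adding [monom c k] to [q] cancels the leading term of the remainder. *)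
pose k := coef (n - d * q) (a + c) / coef d a.
have monom_below x : x < c -> coef (monom c k) x = 0.
  by rewrite coef_monom; case: eqP => // ->; rewrite ltxx.
have pq' : partial_quotient (q + monom c k).
  move=> x q'x y yax.
  have xc : x <= c.
    rewrite leNgt; apply: contra q'x => cx.
    by rewrite coefD q_ge ?ltW // add0r coef_monom gt_eqF.
  have : y <= a + c by apply: le_trans yax _; rewrite posCone_leD2l.
  rewrite mulrDr coefD le_eqVlt => /orP[/eqP ->|yac].
    rewrite (coefM_lead d_below monom_below) coef_monom eqxx.
    by rewrite [coef d a * k]mulrC divfK // coefB addrC subrK.
  rewrite (coefM_below d_below monom_below) // addr0.
  by apply/esym/eqP; rewrite -subr_eq0 -coefB r_below.
have k0 : k != 0 by rewrite mulf_neq0 ?invr_eq0.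
have q'c : coef (q + monom c k) c = k.
  by rewrite coefD q_ge // add0r coef_monom eqxx.
(* The prolonged quotient belongs to the union, which must then be nonzero at [c], against
   [q_ge]. *)
have := union_funE (x := c) (y := c) pq'; rewrite q'c => /(_ k0 (lexx c)) qc.
by move/eqP: k0; apply; rewrite -qc; apply: q_ge.
Qed.

End Division.

(** The least exponents are compared. If that of [u], say [a], is strictly smaller, then
    [coef u a * coef q 0 = coef v a = 0]. *)
Lemma gps_divides_total (G : orderedZmodType) (F : fieldType)
    (u v : gpseries G F) : u != 0 ->
  (exists q, u = v * q) \/ (exists2 q, v = u * q & coef q 0 = 0).
Proof.
move=> u0; have [->|v0] := eqVneq v 0.
  by right; exists 0; rewrite ?mulr0.
have [a ua u_below] := exists_lead u0; have [b vb v_below] := exists_lead v0.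
have [ba|ab] := leP b a.
  left; apply: (gps_divides vb v_below) => x xb.
  by apply: u_below; apply: lt_le_trans ba.
right; have [|q vE] := gps_divides (n := v) ua u_below.
  by move=> x xa; apply: v_below; apply: lt_trans ab.
exists q => //; apply/eqP; have /eqP : coef v a = 0 by apply: v_below.
rewrite vE -[a in X in X -> _]addr0 (coefM_lead u_below).
  by rewrite mulf_eq0 (negPf ua).
by move=> x; rewrite ltNge posCone_ge0.
Qed.

(** * Elements of the fraction field *)

Lemma fractionP (R : idomainType) (a : {fraction R}) :
  exists x y : R, y != 0 /\ a = FracField.tofrac x / FracField.tofrac y.
Proof.
elim/quotW: a => r; exists r.1, r.2; split; first exact: denom_ratioP.
have r20 : FracField.tofrac r.2 != 0 by rewrite tofrac_eq0 denom_ratioP.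
apply: (mulIf r20); rewrite divfK // !piE /FracField.mulf /=.
apply/eqmodP; rewrite /= FracField.equivfE.
by rewrite !numden_Ratio ?mulf_neq0 ?oner_eq0 ?denom_ratioP // !mulr1 mulrC.
Qed.

(** * Prime ideals of [S] *)

Section SeriesRingPrimes.
Variables (F : fieldType) (K : divringClosed F) (G : orderedZmodType).
Local Notation S := (series_ring G K).
Local Notation "x %:F" := (@FracField.tofrac S x).
Implicit Types (x y : S) (q : gpseries G F).

Lemma series_ring_lift q : coef q 0 \in K -> exists x, series x = q.
Proof. by move=> q0; exists (SeriesRing q0). Qed.

Lemma series_ringM x y : series (x * y) = series x * series y.
Proof. by []. Qed.

Lemma series_inj : injective (@series G F K).
Proof. exact: val_inj. Qed.

Lemma prime_coef0 (I : prime_idealr S) x : x \in I -> coef x 0 = 0.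
Proof.
move=> Ix; apply/eqP/negPn/negP => x0.
have below0 (u : gpseries G F) (z : posCone G) : z < 0 -> coef u z = 0.
  by rewrite ltNge posCone_ge0.
have [q qE] := gps_divides (n := 1) x0 (below0 _) (below0 _).
have q0 : coef x 0 * coef q 0 = 1.
  by rewrite -coefM0 -qE /= /Defs.one_fun eqxx.
(* The inverse of [x] lies in [S] because [K] is closed under inverses. *)
have [|y yq] := @series_ring_lift q.
  have -> : coef q 0 = (coef x 0)^-1.
    by apply: (mulfI x0); rewrite q0 divff.
  by rewrite rpredV; have := valP x.
have yx1 : y * x = 1 by apply: series_inj; rewrite series_ringM yq mulrC -qE.
by have := idealMr y Ix; rewrite yx1 idealr1.
Qed.

(** With [a = x1 / y1], the series [q] is [a^-1], [z] is [p * a^-1] and [t] is [p * a^-2]. The last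
    two lie in [S], having constant coefficient 0, even if [q] does not. *)
Lemma prime_frac_of_inv (I : prime_idealr S) (p x1 y1 x2 y2 : S) q :
    p \in I -> y1 != 0 -> y2 != 0 -> x1 * x2 = p * (y1 * y2) ->
    series y1 = series x1 * q ->
  exists2 z, z \in I & z%:F = x2%:F / y2%:F.
Proof.
move=> Ip y10 y20 xyE qE; have p0 := prime_coef0 Ip.
have [|z zE] := @series_ring_lift (series p * q).
  by rewrite coefM0 p0 mul0r rpred0.
have [|t tE] := @series_ring_lift (series z * q).
  by rewrite zE !coefM0 p0 !mul0r rpred0.
have zzE : z * z = p * t.
  by apply: series_inj; rewrite !series_ringM tE {1}zE mulrAC mulrA.
exists z.
  have : t * p \in I by apply: idealMr.
  by rewrite mulrC -zzE prime_idealrM orbb.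
have x10 : x1 != 0.
  apply: contraNneq y10 => x10; apply/eqP/series_inj.
  by rewrite qE x10 mul0r.
have x2E : x2 = z * y2.
  apply: (mulfI x10); rewrite xyE; apply: series_inj.
  by rewrite !series_ringM qE zE -!mulrA mulrCA [q * _]mulrC !mulrA mulrAC.
by rewrite x2E rmorphM mulfK // tofrac_eq0.
Qed.

End SeriesRingPrimes.

Theorem corollary5p9 (F : fieldType) (K : divringClosed F)
  (G : orderedZmodType) : pvd (series_ring G K).
Proof.
move=> I I_QF a b [p /= Ip]; have [x1 [y1 [y10 ->]]] := fractionP a.
have [x2 [y2 [y20 ->]]] := fractionP b => pE.
have xyE : x1 * x2 = p * (y1 * y2).
  apply/eqP; rewrite -tofrac_eq !rmorphM /= pE mulrACA.
  by rewrite !divfK ?tofrac_eq0.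
have series0 (y : series_ring G K) : y != 0 -> series y != 0.
  by rewrite -(inj_eq (@series_inj _ _ _)).
(* Either [a^-1] is a series, or [a] is one with constant coefficient 0. *)
have [[q qE]|[q1 q1E q10]] := gps_divides_total (series x1) (series0 _ y10).
  right; have [z Iz zE] := prime_frac_of_inv Ip y10 y20 xyE qE.
  by exists z.
have [[q qE]|[q2 q2E q20]] := gps_divides_total (series x2) (series0 _ y20).
  have xyE' : x2 * x1 = p * (y2 * y1) by rewrite mulrC xyE [y2 * _]mulrC.
  left; have [z Iz zE] := prime_frac_of_inv Ip y20 y10 xyE' qE.
  by exists z.
have [|z1 z1E] := @series_ring_lift _ K _ q1; first by rewrite q10 rpred0.
have [|z2 z2E] := @series_ring_lift _ K _ q2; first by rewrite q20 rpred0.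
have {}q1E : x1 = y1 * z1 by apply: series_inj; rewrite series_ringM z1E.
have {}q2E : x2 = y2 * z2 by apply: series_inj; rewrite series_ringM z2E.
have zp : z1 * z2 = p.
  apply: (mulIf (mulf_neq0 y10 y20)).
  by rewrite -xyE q1E q2E [RHS]mulrACA mulrC.
have : z1 * z2 \in I by rewrite zp.
rewrite prime_idealrM => /orP[Iz|Iz]; [left; exists z1|right; exists z2] => //.
  by rewrite q1E rmorphM mulrC mulKf // tofrac_eq0.
by rewrite q2E rmorphM mulrC mulKf // tofrac_eq0.
Qed.
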